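(* Let $m \ge 3$ be odd and $n = 3^m-1$. Then the ternary cyclic code $\mathcal{C}_{(0,1,m)}$ has parameters $[n,k,d]$ with $d \ge \frac{3^{(m-1)/2}+13}{2}$ if $m \equiv 1 \pmod 4$ and $d \ge \frac{3^{(m-1)/2}+11}{2}$ if $m \equiv 3 \pmod 4$, and $k = \frac{n}{2}$ if $m \equiv 1 \pmod 4$ and $k = \frac{n+2}{2}$ if $m \equiv 3 \pmod 4$.
   Context: Let $m \ge 2$ be an integer, $n = 3^m-1$, and let $\alpha$ be a primitive element of $\mathbb{F}_{3^m}$. For an integer $0 \le j \le n-1$ with $3$-adic expansion $j = \sum_{t=0}^{m-1} j_t 3^t$, $j_t \in \{0,1,2\}$, let $w_3(j) = \sum_{t=0}^{m-1} j_t$. For distinct $i_1, i_2 \in \{0,1,2,3\}$ let $T_{(i_1,i_2,m)} = \{1 \le j \le n-1 : w_3(j) \equiv i_1 \text{ or } i_2 \pmod 4\}$ and $g_{(i_1,i_2,m)}(x) = \prod_{j \in T_{(i_1,i_2,m)}} (x - \alpha^j) \in \mathbb{F}_3[x]$. $\mathcal{C}_{(i_1,i_2,m)}$ denotes the ternary cyclic code of length $n$ with generator polynomial $g_{(i_1,i_2,m)}(x)$. Parameters $[n,k,d]$ mean length, dimension over $\mathbb{F}_3$, and minimum Hamming distance. *)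

(* Defs.v *)
From HB Require Import structures.
From mathcomp Require Import all_boot all_order all_algebra all_field.
Set Implicit Arguments. Unset Strict Implicit. Unset Printing Implicit Defensive.
Import GRing.Theory.
Local Open Scope ring_scope.

Definition w3 (m j : nat) : nat := (\sum_(t < m) (j %/ 3 ^ t %% 3))%N.

Definition Tset (i1 i2 m : nat) : seq nat :=
  [seq j <- iota 1 (3 ^ m - 2) |
     (w3 m j %% 4 == i1 %% 4)%N || (w3 m j %% 4 == i2 %% 4)%N].

(* the canonical embedding of the prime field F_3 into F (char F = 3) *)
Definition embF3 (F : finFieldType) (a : 'F_3) : F := (val a)%:R.

Definition gen_poly (F : finFieldType) (alpha : F) (i1 i2 m : nat) : {poly F} :=
  \prod_(j <- Tset i1 i2 m) ('X - (alpha ^+ j)%:P).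

Definition word_poly (n : nat) (c : 'rV['F_3]_n) : {poly 'F_3} :=
  \sum_(i < n) (c 0 i)%:P * 'X^i.

Definition cyc_code (F : finFieldType) (alpha : F) (i1 i2 m : nat)
  : {set 'rV['F_3]_(3 ^ m - 1)} :=
  [set c | gen_poly alpha i1 i2 m %| map_poly (@embF3 F) (word_poly c)].

Definition code_dim (n : nat) (C : {set 'rV['F_3]_n}) : nat :=
  \dim <<enum C>>%VS.

Definition wt (n : nat) (c : 'rV['F_3]_n) : nat := #|[set i : 'I_n | c 0 i != 0]|.

(* Main.v *)
Require Import Defs.
From HB Require Import structures.
From mathcomp Require Import all_boot all_order all_algebra all_field.
From mathcomp Require Import zify ring.
Import GRing.Theory.

(** Write [m = 2h + 1], [n = 3^m - 1] and [N = n / 2], whose ternary digits are all [1].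
    Dimension: adding a leading digit shows that the number of [j < 3^m] whose weight
    shifted by [r] lies in [{0, 1}] mod [4] is [3^(m-1)] plus the same number for [m - 1]
    and [r + 1]; the defining set is stable under multiplication by [3], so the generator
    polynomial descends to the prime field and [k = n - |T|].
    Distance: for [a] up to [(3^h + 9) / 2], the number [a (3^h + 1)] repeats the digits
    of [a] twice, while adding [N] gives the digits of [a + (3^h - 1) / 2] twice and one
    more [1].  As the parity of the weight is that of the number, the multiples of
    [N + 3^h + 1] ([h] odd), respectively [N + a (N - 3^h - 1)] ([h] even), stay in the
    defining set, and the BCH bound applies.  The argument needs [h >= 2]; for [m = 3]
    the distance is bounded by the rank of suitable matrices of values of the codeword. *)

(** * Ternary digit sums *)

Lemma w3_cat k l x y : x < 3 ^ k -> w3 (k + l) (x + 3 ^ k * y) = w3 k x + w3 l y.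
Proof.
move=> ltx; rewrite /w3 big_split_ord /=; congr (_ + _).
  apply: eq_bigr => i _.
  have -> : 3 ^ k = 3 ^ i * (3 * 3 ^ (k - i.+1)).
    by rewrite -expnS -expnD; congr (_ ^ _); have := ltn_ord i; lia.
  have -> : x + 3 ^ i * (3 * 3 ^ (k - i.+1)) * y =
            3 ^ (k - i.+1) * y * 3 * 3 ^ i + x by lia.
  by rewrite divnMDl ?expn_gt0 // modnMDl.
apply: eq_bigr => i _; congr (_ %% _).
by rewrite expnD divnMA addnC mulnC divnMDl ?expn_gt0 // (divn_small ltx) addn0.
Qed.

Lemma w30 m : w3 m 0 = 0.
Proof. by rewrite /w3 big1 // => i _; rewrite div0n mod0n. Qed.

Lemma w3_1 x : x < 3 -> w3 1 x = x.
Proof. by move=> ltx; rewrite /w3 big_ord1 divn1 modn_small. Qed.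

Lemma w3S m x : w3 m.+1 x = x %% 3 + w3 m (x %/ 3).
Proof.
have {1}-> : x = x %% 3 + 3 ^ 1 * (x %/ 3) by lia.
by rewrite -[m.+1]add1n w3_cat ?w3_1 ?ltn_mod.
Qed.

Lemma w3_small k m x : k <= m -> x < 3 ^ k -> w3 m x = w3 k x.
Proof.
move=> lekm ltx.
by rewrite -(subnKC lekm) -{1}(addn0 x) -(muln0 (3 ^ k)) w3_cat // w30 addn0.
Qed.

Lemma w3_odd m x : x < 3 ^ m -> odd (w3 m x) = odd x.
Proof.
elim: m x => [|m IHm] x ltx.
  by case: x ltx => // _; rewrite w30.
have ltq : x %/ 3 < 3 ^ m by rewrite ltn_divLR // mulnC -expnS.
rewrite w3S oddD (IHm _ ltq); lia.
Qed.

(** All digits of [3 ^ m - 1] are 2, so the subtraction replaces each digit [d] by [2 - d] without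
    borrowing. *)
Lemma w3_compl m x : x < 3 ^ m -> w3 m (3 ^ m - 1 - x) + w3 m x = 2 * m.
Proof.
elim: m x => [|m IHm] x ltx; first by rewrite /w3 !big_ord0.
have ltq : x %/ 3 < 3 ^ m by rewrite ltn_divLR // mulnC -expnS.
have IH := IHm _ ltq; move: ltx; rewrite expnS => ltx.
have -> : 3 * 3 ^ m - 1 - x = (2 - x %% 3) + 3 ^ 1 * (3 ^ m - 1 - x %/ 3) by lia.
have lt3 : 2 - x %% 3 < 3 by lia.
rewrite (w3S _ x) -[m.+1]add1n w3_cat // w3_1 //; lia.
Qed.

(** * Ternary repunits and repeated digit blocks *)

Definition ones k := (3 ^ k - 1) %/ 2.

Lemma expn3_ones k : 3 ^ k = (2 * ones k).+1.
Proof.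
rewrite /ones; have : odd (3 ^ k) by rewrite oddX orbT.
have := expn_gt0 3 k; lia.
Qed.

Lemma onesS k : ones k.+1 = ones k + 3 ^ k.
Proof. have := expn3_ones k; have := expn3_ones k.+1; rewrite expnS; lia. Qed.

Lemma ones_add k l : ones (k + l) = ones k + 3 ^ k * ones l.
Proof.
have := expn3_ones k; have := expn3_ones l; have := expn3_ones (k + l).
rewrite expnD; nia.
Qed.

Lemma odd_ones k : odd (ones k) = odd k.
Proof. by elim: k => // k IHk; rewrite onesS oddD IHk oddX orbT addbT. Qed.

Lemma w3_twice h a : a < 3 ^ h -> w3 (2 * h + 1) (a * (3 ^ h).+1) = 2 * w3 h a.
Proof.
move=> lta; have -> : a * (3 ^ h).+1 = a + 3 ^ h * a by lia.
have -> : 2 * h + 1 = h + (h + 1) by lia.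
rewrite w3_cat // (@w3_small h (h + 1)) //; lia.
Qed.

(** The bound on [a] keeps [a + ones h] below [3 ^ h], so no carry leaves either block of [h]
    digits. *)
Lemma w3_twice_ones h a : a <= ones h ->
  w3 (2 * h + 1) (a * (3 ^ h).+1 + ones (2 * h + 1)) = 2 * w3 h (a + ones h) + 1.
Proof.
move=> lea; have Eh := expn3_ones h.
have -> : 2 * h + 1 = h + (h + 1) by lia.
rewrite ones_add addn1 onesS.
have -> : a * (3 ^ h).+1 + (ones h + 3 ^ h * (ones h + 3 ^ h)) =
   (a + ones h) + 3 ^ h * ((a + ones h) + 3 ^ h * 1) by nia.
rewrite w3_cat; last lia.
rewrite -addn1 w3_cat ?w3_1 //; lia.
Qed.

(* With [k = 0] or [1] this covers the two values of [a] just beyond the range of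
   the previous lemma that have its parity. *)
Lemma w3_twice_ones_beyond h k : 1 < h -> k <= 1 ->
  w3 (2 * h + 1) ((ones h + 2 + 2 * k) * (3 ^ h).+1 + ones (2 * h + 1)) = 5.
Proof.
move=> h_gt1 lek.
have Eh := expn3_ones h.
have -> : 2 * h + 1 = h + (h + 1) by lia.
rewrite ones_add addn1 onesS.
(* Each block now sums to at least [3 ^ h]: the lower one carries 1 into the upper one, which
   carries 1 into the leading digit. *)
have -> : (ones h + 2 + 2 * k) * (3 ^ h).+1 + (ones h + 3 ^ h * (ones h + 3 ^ h)) =
   (2 * k + 1) + 3 ^ h * ((2 * k + 2) + 3 ^ h * 2) by nia.
have lt9 : 3 ^ 2 <= 3 ^ h by rewrite leq_exp2l.
rewrite w3_cat; last lia.
rewrite -[h.+1]addn1 w3_cat ?w3_1 //; last lia.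
rewrite !(@w3_small 2 h) //; try lia.
by case: k lek => [|[|]] // _; rewrite /w3 !big_ord_recl !big_ord0.
Qed.

(** * Arithmetic progressions inside the defining set *)

Lemma mem_Tset01 m j :
  (j \in Tset 0 1 m) = (0 < j < 3 ^ m - 1) && (w3 m j %% 4 < 2).
Proof.
rewrite mem_filter mem_iota andbC; congr (_ && _); last lia.
have := expn_gt0 3 m; lia.
Qed.

Lemma w3_twice_mod4 h a : 1 < h -> a <= ones h + 5 ->
  w3 (2 * h + 1) (a * (3 ^ h).+1) %% 4 = 2 * odd a.
Proof.
move=> h_gt1 lea; have [lta|] := ltnP a (3 ^ h).
  have := w3_odd _ _ lta; rewrite w3_twice //; lia.
(* The range reaches [3 ^ h] only for [h = 2], at [a = 9]. *)
case: h h_gt1 lea => [|[|[|h]]] // _ lea lta.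
  have -> : a = 9 by move: lea lta; rewrite (_ : ones 2 = 4) //; lia.
  by rewrite /w3 !big_ord_recl big_ord0.
have := expn3_ones h.+3; have : 3 ^ 3 <= 3 ^ h.+3 by rewrite leq_exp2l.
lia.
Qed.

Lemma w3_twice_ones_mod4 h a : 1 < h -> a <= ones h + 5 -> odd a = odd h ->
  w3 (2 * h + 1) (a * (3 ^ h).+1 + ones (2 * h + 1)) %% 4 = 1.
Proof.
move=> h_gt1 lea Eodd; have Oh := odd_ones h; have Eh := expn3_ones h.
have [leh|] := leqP a (ones h).
  have lt : a + ones h < 3 ^ h by lia.
  have := w3_odd _ _ lt; rewrite w3_twice_ones //; lia.
(* [ones h] has the parity of [h], hence of [a], which leaves two of the five values beyond it. *)
move=> gta; have [] : a = ones h + 2 + 2 * 0 \/ a = ones h + 2 + 2 * 1 by lia.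
  by move=> ->; rewrite w3_twice_ones_beyond.
by move=> ->; rewrite w3_twice_ones_beyond.
Qed.

Lemma twice_lt h a : 1 < h -> a <= ones h + 5 ->
  a * (3 ^ h).+1 + ones (2 * h + 1) < 3 ^ (2 * h + 1) - 1.
Proof.
move=> h_gt1 lea; have E := expn3_ones (2 * h + 1); have Eh := expn3_ones h.
have : 3 ^ 2 <= 3 ^ h by rewrite leq_exp2l.
rewrite {1}E; have := expnS 3 (h + h); rewrite expnD.
have -> : (h + h).+1 = 2 * h + 1 by lia.
move=> E2; nia.
Qed.

(** Modulo [2 * N] the multiple [a * N] is 0 for even [a] and [N] for odd [a]; the weights are then
    0 and 1 modulo 4. *)
Lemma Tset01_run_odd h a : 1 < h -> odd h -> 0 < a <= ones h + 5 ->
  exists2 j, j \in Tset 0 1 (2 * h + 1) &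
    a * (ones (2 * h + 1) + (3 ^ h).+1) = j %[mod 3 ^ (2 * h + 1) - 1].
Proof.
move=> h_gt1 odd_h /andP[a_gt0 lea].
set N := ones _; have E : 3 ^ (2 * h + 1) - 1 = 2 * N by rewrite expn3_ones; lia.
exists (a * (3 ^ h).+1 + odd a * N).
  rewrite mem_Tset01; have := twice_lt h a h_gt1 lea; rewrite -/N => ltn.
  case odd_a: (odd a); rewrite ?mul1n ?mul0n ?addn0.
    by rewrite w3_twice_ones_mod4 ?odd_a ?odd_h //; nia.
  by rewrite w3_twice_mod4 ?odd_a //; nia.
rewrite E {1}(divn_eq a 2) modn2.
have -> : (a %/ 2 * 2 + odd a) * (N + (3 ^ h).+1) =
   a %/ 2 * (2 * N) + ((a %/ 2 * 2 + odd a) * (3 ^ h).+1 + odd a * N) by nia.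
by rewrite modnMDl -modn2 -divn_eq.
Qed.

(** The exponent is [-x] modulo [2 * N], where [x] has weight 1 or 2 modulo 4; complementing
    subtracts this from [2 * m], which is 2 modulo 4. Here [a = 0] is admissible, so the run is one
    longer than for odd [h]. *)
Lemma Tset01_run_even h a : 1 < h -> ~~ odd h -> a <= ones h + 5 ->
  exists2 j, j \in Tset 0 1 (2 * h + 1) &
    ones (2 * h + 1) + a * (ones (2 * h + 1) - (3 ^ h).+1)
      = j %[mod 3 ^ (2 * h + 1) - 1].
Proof.
move=> h_gt1 even_h lea.
set N := ones _; have E : 3 ^ (2 * h + 1) - 1 = 2 * N by rewrite expn3_ones; lia.
have ltn := twice_lt h a h_gt1 lea.
have lt5 : 1 * (3 ^ h).+1 + ones (2 * h + 1) < 3 ^ (2 * h + 1) - 1.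
  by apply: twice_lt; lia.
rewrite -/N in ltn lt5.
set x := a * (3 ^ h).+1 + ~~ odd a * N.
have ltx : x < 2 * N by rewrite /x; case: (odd a); lia.
have gtx : 0 < x by rewrite /x; case: a {lea ltn x ltx} => [|a]; lia.
have wx : w3 (2 * h + 1) x %% 4 = odd a + 1.
  rewrite /x; case odd_a: (odd a); rewrite ?mul1n ?mul0n ?addn0.
    by rewrite w3_twice_mod4 ?odd_a.
  by rewrite w3_twice_ones_mod4 ?odd_a ?(negbTE even_h).
exists (2 * N - x).
  have := w3_compl (2 * h + 1) x; rewrite E mem_Tset01 => wc.
  have /wc {}wc : x < 3 ^ (2 * h + 1) by lia.
  by rewrite E; apply/andP; split; lia.
rewrite E; apply/eqP; rewrite -(eqn_modDr x) (subnK (ltnW ltx)) modnn /x.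
have le3N : a * (3 ^ h).+1 <= a * N by rewrite leq_mul2l; lia.
have -> : N + a * (N - (3 ^ h).+1) + (a * (3 ^ h).+1 + ~~ odd a * N) =
   (1 + a + ~~ odd a) * N.
  by rewrite mulnBr addnA -(addnA N) subnK // !mulnDl mul1n.
have -> : 1 + a + ~~ odd a = (1 + a %/ 2) * 2 by lia.
by rewrite -mulnA modnMl.
Qed.

Lemma expn3_factor h : 3 ^ (2 * h + 1) = 3 * (3 ^ h - 1) * (3 ^ h).+1 + 3.
Proof.
rewrite addn1 expnS mul2n -addnn expnD.
by case: (3 ^ h) (expn_gt0 3 h) => // z _; rewrite subn1 /=; lia.
Qed.

(** A common divisor of [v] and [N] divides [3 ^ h + 1], hence also 2, the remainder of [2 * N] in
    its factorization; it is odd because [N] is. *)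
Lemma coprime_run_step h v : 0 < h ->
  v = ones (2 * h + 1) + (3 ^ h).+1 \/ v + (3 ^ h).+1 = ones (2 * h + 1) ->
  coprime v (3 ^ (2 * h + 1) - 1).
Proof.
move=> h_gt0; set N := ones _ => Ev.
have E : 3 ^ (2 * h + 1) - 1 = 2 * N by rewrite expn3_ones; lia.
have oN : odd N by rewrite odd_ones; lia.
have o3 : odd (3 ^ h) by rewrite oddX orbT.
have ov : odd v by lia.
rewrite E coprimeMr coprimen2 ov /=.
set d := gcdn v N.
have dv : d %| v by rewrite dvdn_gcdl.
have dN : d %| N by rewrite dvdn_gcdr.
have d3 : d %| (3 ^ h).+1.
  by case: Ev => Ev; move: dv dN; [rewrite Ev | rewrite -Ev] => dv dN;
     [rewrite -(dvdn_addr _ dN) | rewrite -(dvdn_addr _ dv)].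
have E2 : 2 * N = 3 * (3 ^ h - 1) * (3 ^ h).+1 + 2.
  by rewrite -E expn3_factor -addnBA.
have d2 : d %| 2.
  by rewrite -(dvdn_addr _ (dvdn_mull (3 * (3 ^ h - 1)) d3)) -E2 dvdn_mull.
have od : odd d by apply: dvdn_odd dN oN.
rewrite /coprime -/d; move: (dvdn_leq (isT : 0 < 2) d2) od.
by clearbody d; case: d {dv dN d3 d2} => [|[|[|]]].
Qed.

(** * Size of the defining set *)

Lemma count_w3_step (p : pred nat) m :
  count (fun j => p (w3 m.+1 j)) (iota 0 (3 ^ m.+1)) =
  count (fun j => p (w3 m j)) (iota 0 (3 ^ m)) +
  count (fun j => p (w3 m j).+1) (iota 0 (3 ^ m)) +
  count (fun j => p (w3 m j).+2) (iota 0 (3 ^ m)).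
Proof.
have -> : 3 ^ m.+1 = 3 ^ m + 3 ^ m + 3 ^ m by rewrite expnS; lia.
have block d : d < 3 -> count (fun j => p (w3 m.+1 j)) (iota (3 ^ m * d) (3 ^ m)) =
    count (fun j => p (w3 m j + d)) (iota 0 (3 ^ m)).
  move=> ltd; rewrite -[3 ^ m * d]addn0 iotaDl count_map; apply: eq_in_count => j.
  rewrite mem_iota /= => ltj.
  by rewrite addnC -addn1 w3_cat ?w3_1.
rewrite !iotaD !count_cat !add0n.
have := block 0 isT; have := block 1 isT; have := block 2 isT.
rewrite muln0 muln1 muln2 -addnn => -> -> ->; congr (_ + _ + _); apply: eq_count => j;
  by rewrite ?addn0 ?addn1 ?addn2.
Qed.

(* The residues [0, 1] and [2, 3] are complementary, so two of the three terms of
   [count_w3_step] add up to [3 ^ m]. *)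
Lemma count_w3_mod4 m r :
  2 * count (fun j => (w3 m j + r) %% 4 < 2) (iota 0 (3 ^ m)) + 1 =
  3 ^ m + 2 * ((r + m) %% 4 < 2).
Proof.
elim: m r => [|m IHm] r; first by rewrite /= w30 add0n addn0; lia.
rewrite (count_w3_step (fun w => (w + r) %% 4 < 2)).
have := IHm r.+1; rewrite addSnnS.
have -> : count (fun j => (w3 m j + r.+1) %% 4 < 2) (iota 0 (3 ^ m)) =
          count (fun j => ((w3 m j).+1 + r) %% 4 < 2) (iota 0 (3 ^ m)).
  by apply: eq_count => j; rewrite addSnnS.
have := count_predC (fun j => (w3 m j + r) %% 4 < 2) (iota 0 (3 ^ m)).
rewrite size_iota.
have -> : count (predC (fun j => (w3 m j + r) %% 4 < 2)) (iota 0 (3 ^ m)) =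
          count (fun j => ((w3 m j).+2 + r) %% 4 < 2) (iota 0 (3 ^ m)).
  by apply: eq_count => j /=; lia.
rewrite expnS; lia.
Qed.

Lemma size_Tset01 m : odd m ->
  2 * size (Tset 0 1 m) + 3 = 3 ^ m + 2 * (m %% 4 < 2).
Proof.
move=> odd_m; have m_gt0 : 0 < m by case: m odd_m.
have := count_w3_mod4 m 0; rewrite add0n => <-.
have E3 : 3 ^ m = 1 + (3 ^ m - 2) + 1.
  have : 3 ^ 1 <= 3 ^ m by rewrite leq_exp2l.
  lia.
have -> : iota 0 (3 ^ m) = 0 :: iota 1 (3 ^ m - 2) ++ [:: 3 ^ m - 1].
  by rewrite {1}E3 !iotaD /= add0n; congr (_ :: _ ++ [:: _]); lia.
(* Of the two endpoints outside the defining set only 0 is counted: [3 ^ m - 1] has weight [2 * m],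
   which is 2 modulo 4 for odd [m]. *)
have := w3_compl m 0 (expn_gt0 3 m); rewrite w30 subn0 => w3max.
rewrite /= count_cat /= w30 -size_filter.
have -> : [seq j <- iota 1 (3 ^ m - 2) | (w3 m j + 0) %% 4 < 2] = Tset 0 1 m.
  by apply: eq_in_filter => j _; lia.
lia.
Qed.

Local Open Scope ring_scope.

(** * Values of codewords and lower bounds for the weight *)

Lemma embF3_rmorph (F : finFieldType) : 3%N \in [pchar F] ->
  {f : {rmorphism 'F_3 -> F} | embF3 F =1 f}.
Proof.
move=> char3.
have fB : zmod_morphism (embF3 F).
  move=> a b; apply/eqP; rewrite eq_sym subr_eq; apply/eqP.
  rewrite /embF3 -natrD -[in RHS](GRing.natr_mod_pchar char3); congr (_%:R).
  by rewrite -[in LHS](subrK b a).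
have fM : monoid_morphism (embF3 F).
  split=> // a b.
  by rewrite /embF3 -natrM -[in RHS](GRing.natr_mod_pchar char3).
pose fz := GRing.isZmodMorphism.Build _ _ (embF3 F) fB.
pose fm := GRing.isMonoidMorphism.Build _ _ (embF3 F) fM.
pose f : {rmorphism 'F_3 -> F} := HB.pack (embF3 F) fz fm.
by exists f.
Qed.

(** At the powers of a primitive [n]-th root of unity these are the discrete Fourier coefficients of
    [c]. *)
Definition word_eval {F : finFieldType} {n} (c : 'rV['F_3]_n) (x : F) : F :=
  (map_poly (embF3 F) (word_poly c)).[x].

Lemma word_polyE n (c : 'rV['F_3]_n) : word_poly c = rVpoly c.
Proof.
rewrite /word_poly; apply/polyP => i; rewrite coef_rVpoly coef_sum.
case: insubP => [j _ Ej|]; last first.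
  rewrite -leqNgt => len; rewrite big1 // => j _; rewrite coefCM coefXn.
  by rewrite gtn_eqF ?mulr0 // (leq_trans (ltn_ord j)).
rewrite (bigD1 j) //= coefCM coefXn -Ej eqxx mulr1 big1 ?addr0 // => k neqk.
by rewrite coefCM coefXn (inj_eq val_inj) eq_sym (negbTE neqk) mulr0.
Qed.

Lemma word_evalE (F : finFieldType) n (c : 'rV['F_3]_n) (x : F) :
  3%N \in [pchar F] -> word_eval c x = \sum_(i < n) embF3 F (c 0 i) * x ^+ i.
Proof.
move=> /embF3_rmorph[f Ef]; rewrite /word_eval (eq_map_poly Ef) rmorph_sum horner_sum.
apply: eq_bigr => i _.
by rewrite Ef /= rmorphM /= map_polyC map_polyXn hornerM hornerC hornerXn.
Qed.

Lemma word_eval_expr3 (F : finFieldType) n (c : 'rV['F_3]_n) (x : F) :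
  3%N \in [pchar F] -> word_eval c (x ^+ 3) = word_eval c x ^+ 3.
Proof.
move=> char3; rewrite -(GRing.pFrobenius_autE char3 (word_eval _ _)) !word_evalE // rmorph_sum.
apply: eq_bigr => i _; rewrite rmorphM /= rmorphXn /= !GRing.pFrobenius_autE.
rewrite -exprM mulnC exprM.
by rewrite -(GRing.pFrobenius_autE char3 (embF3 _ _)) /embF3 GRing.pFrobenius_aut_nat.
Qed.

(* The [r x r] matrix below factors through the support of [c], so its rank is at
   most the weight; being triangular with nonzero diagonal, it has rank [r]. *)
Lemma wt_ge_triangular (F : finFieldType) n (c : 'rV['F_3]_n) (x : F) r
    (e s : nat -> nat) : 3%N \in [pchar F] ->
  (forall k, (k < r)%N -> word_eval c (x ^+ (e k + s k)) != 0) ->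
  (forall l k, (l < k < r)%N -> word_eval c (x ^+ (e l + s k)) = 0) ->
  (r <= wt c)%N.
Proof.
move=> char3 diag trig.
pose M : 'M[F]_r := \matrix_(l, k) word_eval c (x ^+ (e l + s k)).
have trigM : is_trig_mx M.
  by apply/is_trig_mxP => l k ltlk; rewrite mxE trig // ltlk /=.
have unitM : M \in unitmx.
  rewrite unitmxE det_trig // unitfE; apply/prodf_neq0 => k _.
  by rewrite mxE diag.
pose S := [set i : 'I_n | c 0 i != 0].
pose A : 'M[F]_(r, #|S|) := \matrix_(l, i) (x ^+ e l) ^+ (enum_val i : 'I_n).
pose B : 'M[F]_(#|S|, r) :=
  \matrix_(i, k) (embF3 F (c 0 (enum_val i)) * (x ^+ s k) ^+ (enum_val i : 'I_n)).
have EM : M = A *m B.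
  apply/matrixP => l k; rewrite !mxE word_evalE //.
  rewrite (bigID (mem S)) /= [X in _ + X]big1 ?addr0; last first.
    by move=> i; rewrite inE negbK => /eqP->; rewrite /embF3 mul0r.
  rewrite big_enum_val; apply: eq_bigr => i _.
  by rewrite !mxE exprD exprMn mulrCA.
by rewrite -(mxrank_unit unitM) EM mulmx_max_rank.
Qed.

Lemma word_eval_mod (F : finFieldType) n (c : 'rV['F_3]_n) (x : F) i j :
  n.-primitive_root x -> i = j %[mod n] ->
  word_eval c (x ^+ i) = word_eval c (x ^+ j).
Proof. by move=> prim Eij; rewrite -(prim_expr_mod prim i) Eij prim_expr_mod. Qed.

(** A nonzero polynomial of degree below [n] cannot vanish at [n] distinct points. *)
Lemma word_eval_neq0 (F : finFieldType) n (c : 'rV['F_3]_n) (x : F) :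
  3%N \in [pchar F] -> n.-primitive_root x -> c != 0 ->
  exists j, word_eval c (x ^+ j) != 0.
Proof.
move=> /embF3_rmorph[f Ef] prim c0.
case: (boolP [exists j : 'I_n, word_eval c (x ^+ j) != 0]).
  by case/existsP=> j nz; exists j.
move=> /existsPn all0; case/eqP: c0.
rewrite -[c]rVpolyK -word_polyE; suff -> : word_poly c = 0 by rewrite linear0.
apply/eqP; rewrite -(map_poly_eq0 f); apply/negPn/negP => nz.
pose rs := [seq x ^+ nat_of_ord j | j <- enum 'I_n].
have allr : all (root (map_poly f (word_poly c))) rs.
  apply/allP => y /mapP[j _ ->]; have := all0 j.
  by rewrite negbK /word_eval (eq_map_poly Ef).
have uniqr : uniq rs.
  rewrite map_inj_uniq ?enum_uniq // => i j /eqP.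
  rewrite (eq_prim_root_expr prim) !modn_small ?ltn_ord // => /eqP; exact: val_inj.
have := max_poly_roots nz allr uniqr.
rewrite size_map size_enum_ord size_map_poly word_polyE ltnNge.
by rewrite /rVpoly size_poly.
Qed.

(** Prolong the run up to its first nonzero value, at [a0]; the Toeplitz matrix with that value on
    the diagonal is triangular of size [L + 1]. *)
Lemma bch_bound (F : finFieldType) n (c : 'rV['F_3]_n) (x : F) L b v :
  3%N \in [pchar F] -> n.-primitive_root x -> c != 0 -> coprime v n ->
  (forall a, (a < L)%N -> word_eval c (x ^+ (b + a * v)) = 0) ->
  (L < wt c)%N.
Proof.
move=> char3 prim c0 cop run; have n_gt0 := prim_order_gt0 prim.
have [j nzj] := word_eval_neq0 F n c x char3 prim c0.
have exa : exists a, word_eval c (x ^+ (b + a * v)) != 0.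
  have [u _ Eu] := Bezoutl v n_gt0; rewrite gcdnC (eqP cop) in Eu.
  (* Since [u * v] is -1 modulo [n], the index [(b - j) * u] leads to [j]; [n - 1] stands for -1. *)
  exists ((b + (n - 1) * j) * u)%N; rewrite (word_eval_mod F n c x _ j) //.
  have En : (j + (n - 1) * j = j * n)%N by nia.
  apply/eqP; rewrite -(eqn_modDr ((n - 1) * j)) En modnMl.
  have -> : (b + (b + (n - 1) * j) * u * v + (n - 1) * j =
    (b + (n - 1) * j) * (1 + u * v))%N by lia.
  exact: dvdn_mull.
have [a0 nza mina0] := ex_minnP exa.
have leL : (L <= a0)%N by rewrite leqNgt; apply/negP => /run /eqP; exact/negP.
apply: (wt_ge_triangular F n c x L.+1 (fun l => l * v)%N (fun k => b + (a0 - k) * v)%N) => //.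
  move=> k lek; rewrite addnCA -mulnDl subnKC //; lia.
move=> l k /andP[ltlk ltk]; rewrite addnCA -mulnDl; apply/eqP/negPn/negP => /mina0.
lia.
Qed.

Lemma cyc_code_zero (F : finFieldType) (alpha : F) i1 i2 m c j :
  c \in cyc_code alpha i1 i2 m -> j \in Tset i1 i2 m ->
  word_eval c (alpha ^+ j) = 0.
Proof.
rewrite inE => dvd jT; apply/eqP; rewrite -[_ == 0]/(root _ _).
rewrite -dvdp_XsubCl; apply: dvdp_trans dvd; rewrite dvdp_XsubCl /gen_poly.
rewrite -(big_map (fun j => alpha ^+ j) predT (fun z => 'X - z%:P)).
by rewrite root_prod_XsubC map_f.
Qed.

(** * Frobenius stability and the dimension *)

(** Multiplication by 3 modulo [3 ^ m - 1] rotates the [m] digits cyclically. *)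
Lemma w3_rot m j : (0 < j < 3 ^ m - 1)%N ->
  (0 < 3 * j %% (3 ^ m - 1) < 3 ^ m - 1)%N /\ w3 m (3 * j %% (3 ^ m - 1)) = w3 m j.
Proof.
case: m => [|m]; first lia.
move=> ltj; set n := (3 ^ m.+1 - 1)%N.
have Ej := divn_eq j (3 ^ m); set d := (j %/ 3 ^ m)%N in Ej; set q := (j %% 3 ^ m)%N in Ej.
have ltq : (q < 3 ^ m)%N by rewrite ltn_mod expn_gt0.
have ltd : (d < 3)%N by rewrite ltn_divLR ?expn_gt0 // -expnS; lia.
have E3 : (3 ^ m.+1 = 3 * 3 ^ m)%N by rewrite expnS.
have E : (3 * j = d * n + (d + 3 * q))%N by rewrite Ej /n E3; nia.
have ltx : (d + 3 * q < n)%N.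
  rewrite /n E3; have [|] := ltnP q.+1 (3 ^ m); first lia.
  move=> geq; have Eq : (q.+1 = 3 ^ m)%N by lia.
  suff : d != 2%N by lia.
  by apply/eqP => d2; move: ltj; rewrite Ej d2 E3; lia.
rewrite E modnMDl modn_small //; split; first by nia.
have -> : (d + 3 * q = d + 3 ^ 1 * q)%N by rewrite expn1.
rewrite -{1}add1n w3_cat ?w3_1 // Ej addnC [(d * _)%N]mulnC (addnC _ q).
by rewrite -addn1 w3_cat ?w3_1.
Qed.

Lemma perm_Tset01_rot m :
  perm_eq [seq (3 * j %% (3 ^ m - 1))%N | j <- Tset 0 1 m] (Tset 0 1 m).
Proof.
have uT : uniq (Tset 0 1 m) by rewrite filter_uniq ?iota_uniq.
have stab : {subset [seq (3 * j %% (3 ^ m - 1))%N | j <- Tset 0 1 m] <= Tset 0 1 m}.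
  move=> i /mapP[j]; rewrite mem_Tset01 => /andP[ltj wj] ->.
  by have [lt w] := w3_rot m j ltj; rewrite mem_Tset01 lt w wj.
have uR : uniq [seq (3 * j %% (3 ^ m - 1))%N | j <- Tset 0 1 m].
  rewrite map_inj_in_uniq // => i j; rewrite !mem_Tset01.
  move=> /andP[/andP[_ lti] _] /andP[/andP[_ ltj] _] /eqP.
  case: m lti ltj {uT stab} => [|m] lti ltj; first by move: lti; rewrite expn0.
  have inv k : (3 ^ m * (3 * k) = k %[mod 3 ^ m.+1 - 1])%N.
    have -> : (3 ^ m * (3 * k) = k * (3 ^ m.+1 - 1) + k)%N.
      by have := expn_gt0 3 m; rewrite expnS; nia.
    by rewrite modnMDl.
  move/eqP=> Eij; rewrite -(modn_small lti) -(modn_small ltj) -inv -[RHS]inv.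
  by rewrite -modnMmr Eij modnMmr.
apply: uniq_perm => //; apply: (uniq_min_size uR stab _).2.
by rewrite size_map.
Qed.

Lemma expr3_id_embF3 (F : finFieldType) (a : F) :
  3%N \in [pchar F] -> a ^+ 3 = a -> exists b, embF3 F b = a.
Proof.
move=> char3 Ea.
have : (a * (a - 1)) * (a + 1) = 0 by rewrite -[RHS](subrr a) -{4}Ea; ring.
move/eqP; rewrite !mulf_eq0 -orbA subr_eq0 addr_eq0 => /or3P[] /eqP ->.
- by exists 0.
- by exists 1.
exists (-1); apply/eqP; rewrite -addr_eq0 /embF3 natr1; apply/eqP.
exact: (GRing.pcharf0 char3).
Qed.

(** Cubing permutes the roots, so it fixes every coefficient, and the fixed points of cubing form
    the prime field. *)
Lemma gen_poly_descent (F : finFieldType) (alpha : F) m :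
  3%N \in [pchar F] -> (3 ^ m - 1).-primitive_root alpha ->
  exists g0 : {poly 'F_3}, map_poly (embF3 F) g0 = gen_poly alpha 0 1 m.
Proof.
move=> char3 prim; set g := gen_poly _ _ _ _.
have Eg : map_poly (pFrobenius_aut char3) g = g.
  rewrite /g /gen_poly rmorph_prod -[RHS](perm_big _ (perm_Tset01_rot m)) big_map /=.
  apply: eq_bigr => j _; rewrite rmorphB /= map_polyX map_polyC /=.
  by rewrite GRing.pFrobenius_autE -exprM mulnC (prim_expr_mod prim).
have coefg i : exists b, embF3 F b == g`_i.
  have [] := @expr3_id_embF3 F g`_i char3; last by move=> b /eqP; exists b.
  by rewrite -(GRing.pFrobenius_autE char3) -coef_map Eg.
exists (\poly_(i < size g) xchoose (coefg i)).
have [f Ef] := embF3_rmorph F char3; rewrite (eq_map_poly Ef).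
apply/polyP => i; rewrite coef_map coef_poly; case: ltnP => lti.
  by apply: etrans (esym (Ef _)) _; apply/eqP/(xchooseP (coefg i)).
by rewrite raddf0 nth_default.
Qed.

Lemma size_gen_poly (F : finFieldType) (alpha : F) i1 i2 m :
  size (gen_poly alpha i1 i2 m) = (size (Tset i1 i2 m)).+1.
Proof. by rewrite /gen_poly size_prod_XsubC. Qed.

(** Multiplication by [g0] maps the polynomials of degree below [n - t] injectively and linearly
    onto the code. *)
Lemma dim_cyc_code01 (F : finFieldType) (alpha : F) m :
  3%N \in [pchar F] -> (3 ^ m - 1).-primitive_root alpha ->
  (code_dim (cyc_code alpha 0 1 m) + size (Tset 0 1 m) = 3 ^ m - 1)%N.
Proof.
move=> char3 prim; have [g0 Eg0] := gen_poly_descent F alpha m char3 prim.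
have [f Ef] := embF3_rmorph F char3.
have sg : size g0 = (size (Tset 0 1 m)).+1.
  by rewrite -(size_gen_poly F alpha) -Eg0 (eq_map_poly Ef) size_map_poly.
have g0nz : g0 != 0 by rewrite -size_poly_gt0 sg.
set n := (3 ^ m - 1)%N; set t := size (Tset 0 1 m) in sg *.
have letn : (t <= n)%N.
  rewrite /t size_filter (leq_trans (count_size _ _)) // size_iota /n.
  by rewrite leq_sub2l.
have memC c : (c \in cyc_code alpha 0 1 m) = (g0 %| rVpoly c).
  by rewrite inE -Eg0 !(eq_map_poly Ef) dvdp_map word_polyE.
pose phi (q : 'rV['F_3]_(n - t)) : 'rV['F_3]_n := poly_rV (rVpoly q * g0).
have linphi : linear phi.
  by move=> a u v; rewrite /phi linearP /= mulrDl -scalerAl linearP.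
pose phi_lin := GRing.isLinear.Build _ _ _ _ phi linphi.
pose Phi : {linear 'rV['F_3]_(n - t) -> 'rV['F_3]_n} := HB.pack phi phi_lin.
have sizephi (q : 'rV['F_3]_(n - t)) : (size (rVpoly q * g0)%R <= n)%N.
  have : (size (rVpoly q) <= n - t)%N by apply: size_poly.
  have := size_polyMleq (rVpoly q) g0; rewrite sg; lia.
have phiK q : rVpoly (phi q) = rVpoly q * g0 by rewrite /phi poly_rV_K.
have spanC : <<enum (cyc_code alpha 0 1 m)>>%VS = limg (linfun Phi).
  apply/eqP; rewrite eqEsubv; apply/andP; split.
    apply/span_subvP => c; rewrite mem_enum memC => /dvdpP[q Eq].
    have sq : (size q <= n - t)%N.
      have [->|qnz] := eqVneq q 0; first by rewrite size_poly0.
      have : (size (rVpoly c) <= n)%N by apply: size_poly.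
      by rewrite Eq size_mul // sg addnS /= -(leq_add2r t (size q)) subnK.
    suff -> : c = linfun Phi (poly_rV q) by rewrite memv_img ?memvf.
    by rewrite lfunE /= /phi poly_rV_K // -Eq rVpolyK.
  apply/subvP => c /memv_imgP[q _ ->]; rewrite lfunE memv_span // mem_enum memC.
  by rewrite /= phiK dvdp_mull.
have kerPhi : lker (linfun Phi) == 0%VS.
  apply/lker0P => u v; rewrite !lfunE /= => /(congr1 rVpoly); rewrite !phiK.
  by move/(mulIf g0nz)/(congr1 (@poly_rV _ (n - t))); rewrite !rVpolyK.
rewrite /code_dim spanC limg_dim_eq ?(eqP kerPhi) ?capv0 //.
by rewrite dimvf /dim /= mul1n subnK.
Qed.

(** * The case [m = 3] *)

(** A certificate that can be checked by computation: [Z] lists exponents of known zeros, [N]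
    exponents of known nonzero values. *)
Definition triangular_mod (n : nat) (Z N e s : seq nat) : bool :=
  all (fun k => ((nth 0 e k + nth 0 s k) %% n \in N) &&
         all (fun l => (nth 0 e l + nth 0 s k) %% n \in Z) (iota 0 k))%N
    (iota 0 (size e)).

Lemma wt_ge_triangular_mod (F : finFieldType) n (c : 'rV['F_3]_n) (x : F)
    (Z N e s : seq nat) : 3%N \in [pchar F] -> n.-primitive_root x ->
  {in Z, forall j, word_eval c (x ^+ j) = 0} ->
  {in N, forall j, word_eval c (x ^+ j) != 0} ->
  triangular_mod n Z N e s -> (size e <= wt c)%N.
Proof.
move=> char3 prim zero nonzero /allP cert.
have mem_e k : (k < size e)%N -> k \in iota 0 (size e) by rewrite mem_iota.
apply: (wt_ge_triangular F n c x _ (nth 0%N e) (nth 0%N s)) => //.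
  by move=> k /mem_e/cert/andP[inN _]; rewrite -(prim_expr_mod prim) nonzero.
move=> l k /andP[ltlk /mem_e/cert/andP[_ /allP inZ]].
by rewrite -(prim_expr_mod prim) zero // inZ // mem_iota.
Qed.

(* For [m = 3] the run of zeros [22, 23, 24, 25] can be prolonged through [0] and [1]
   when [c] vanishes at [1].  Otherwise the triangular matrices come from the shifting
   procedure of van Lint and Wilson, after a case split on the vanishing of [c] at the
   cyclotomic classes of [13], [2] and [4]. *)
Lemma wt_cyc_code01_m3 (F : finFieldType) (alpha : F) c :
  3%N \in [pchar F] -> (3 ^ 3 - 1).-primitive_root alpha ->
  c \in cyc_code alpha 0 1 3 -> c != 0 -> (7 <= wt c)%N.
Proof.
move=> char3 prim cC c0.
pose z j := word_eval c (alpha ^+ j) == 0.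
pose T := [:: 1; 3; 8; 9; 14; 16; 17; 20; 22; 23; 24; 25]%N.
have zT : all z T.
  apply/allP => j jT; apply/eqP/(cyc_code_zero _ _ _ _ _ _ _ cC).
  rewrite mem_Tset01; apply/allP: j jT.
  by rewrite /w3 /= !big_ord_recl !big_ord0.
have z3 j : z (3 * j %% 26)%N = z j.
  rewrite /z (prim_expr_mod prim) mulnC exprM word_eval_expr3 //.
  by rewrite expf_eq0.
have z6 : z 6%N = z 2%N by apply: (z3 2%N).
have z18 : z 18%N = z 2%N by rewrite -z6; apply: (z3 6%N).
have z12 : z 12%N = z 4%N by apply: (z3 4%N).
have z10 : z 10%N = z 4%N by rewrite -z12; apply: (z3 12%N).
have [z0|nz0] := boolP (z 0%N).
  have /allP zT0 : all z (0%N :: T) by rewrite /= z0.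
  apply: (bch_bound F _ c alpha 6 22 1 char3 prim c0 (coprime1n _)) => a lta.
  rewrite -(prim_expr_mod prim); apply/eqP/zT0.
  by case: a lta => [|[|[|[|[|[|]]]]]].
have cert Z N e s : all z Z -> all (predC z) N -> triangular_mod 26 Z N e s ->
    (size e <= wt c)%N.
  move=> /allP zZ /allP nzN.
  apply: (wt_ge_triangular_mod F _ c alpha Z N e s char3 prim) => j jin; last exact: nzN.
  exact/eqP/zZ.
clearbody z; have [z13|nz13] := boolP (z 13%N); have [z2|nz2] := boolP (z 2%N).
- apply: (cert ([:: 13; 2; 6; 18] ++ T) [:: 0]
    [:: 0; 25; 23; 17; 9; 3; 1] [:: 0; 1; 3; 9; 17; 23; 25])%N => //.
    by rewrite all_cat zT /= z6 z18 z13 z2.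
  by rewrite /= nz0.
- apply: (cert (13 :: T) [:: 0; 2; 6; 18]
    [:: 0; 25; 18; 15; 4; 17; 1] [:: 0; 1; 14; 17; 24; 9; 25])%N => //.
    by rewrite /= z13.
  by rewrite /= z6 z18 nz0 nz2.
- apply: (cert ([:: 2; 6; 18] ++ T) [:: 0; 13]
    [:: 0; 25; 24; 10; 2; 21; 1] [:: 0; 1; 2; 3; 24; 18; 25])%N => //.
    by rewrite all_cat zT /= z6 z18 z2.
  by rewrite /= nz0 nz13.
have [z4|nz4] := boolP (z 4%N).
- apply: (cert ([:: 4; 10; 12] ++ T) [:: 0; 13; 2; 6; 18]
    [:: 0; 25; 18; 11; 15; 17; 1] [:: 0; 1; 10; 17; 24; 9; 25])%N => //.
    by rewrite all_cat zT /= z10 z12 z4.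
  by rewrite /= z6 z18 nz0 nz13 nz2.
apply: (cert T [:: 0; 13; 2; 6; 18; 4; 10; 12]
  [:: 0; 5; 3; 18; 12; 1; 4] [:: 0; 1; 3; 20; 24; 17; 22])%N => //.
by rewrite /= z6 z18 z10 z12 nz0 nz13 nz2 nz4.
Qed.

Theorem theorem5 (m : nat) (F : finFieldType) (alpha : F) :
  (3 <= m)%N -> odd m -> #|F| = (3 ^ m)%N ->
  (3 ^ m - 1).-primitive_root alpha ->
  ((m %% 4 = 1)%N ->
     (2 * code_dim (cyc_code alpha 0 1 m) = 3 ^ m - 1)%N /\
     (forall c, c \in cyc_code alpha 0 1 m -> c != 0%R ->
        (3 ^ ((m - 1) %/ 2) + 13 <= 2 * wt c)%N)) /\
  ((m %% 4 = 3)%N ->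
     (2 * code_dim (cyc_code alpha 0 1 m) = (3 ^ m - 1) + 2)%N /\
     (forall c, c \in cyc_code alpha 0 1 m -> c != 0%R ->
        (3 ^ ((m - 1) %/ 2) + 11 <= 2 * wt c)%N)).
Proof.
move=> m_ge3 odd_m cardF prim.
have char3 : 3%N \in [pchar F] by apply: card_finPcharP cardF _.
have dimC := dim_cyc_code01 F alpha m char3 prim.
have sizeT := size_Tset01 m odd_m.
have Em : m = (2 * ((m - 1) %/ 2) + 1)%N by lia.
move: Em dimC sizeT; set h := ((m - 1) %/ 2)%N => Em dimC sizeT.
have E3h := expn3_ones h.
split=> m4; (split; first by move: dimC sizeT; rewrite m4 /=; lia); move=> c cC c0.
  have h_gt1 : (1 < h)%N by lia.
  have even_h : ~~ odd h by lia.
  (* The required [(3 ^ h + 13) / 2] equals [ones h + 7], one more than the length of the run. *)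
  suff : (ones h + 6 < wt c)%N by rewrite E3h; lia.
  apply: (bch_bound F _ c alpha _ (ones m) (ones m - (3 ^ h).+1) char3 prim c0).
    rewrite Em; apply: coprime_run_step; first lia.
    right; rewrite subnK //.
    by have := twice_lt h 1 h_gt1; have := expn3_ones (2 * h + 1); lia.
  move=> a lta.
  have [|j jT Ej] := Tset01_run_even h a h_gt1 even_h; first lia.
  rewrite -Em in jT Ej; rewrite (word_eval_mod F _ c alpha _ j prim Ej).
  exact: cyc_code_zero jT.
have [h_le1|h_gt1] := leqP h 1.
  have h1 : h = 1%N by lia.
  have m3 : m = 3%N by lia.
  rewrite h1; move: c cC c0 prim; rewrite m3 => c cC c0 prim.
  by have := wt_cyc_code01_m3 F alpha c char3 prim cC c0; lia.
have odd_h : odd h by lia.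
suff : (ones h + 5 < wt c)%N by rewrite E3h; lia.
(* The run starts at the first multiple of the step, because the exponent 0 is outside the defining
   set. *)
apply: (bch_bound F _ c alpha _ (ones m + (3 ^ h).+1) (ones m + (3 ^ h).+1) char3 prim c0).
  by rewrite Em; apply: coprime_run_step; [lia | left].
move=> a lta.
have [|j jT Ej] := Tset01_run_odd h a.+1 h_gt1 odd_h; first lia.
rewrite -Em mulSn in jT Ej; rewrite (word_eval_mod F _ c alpha _ j prim Ej).
exact: cyc_code_zero jT.
Qed.
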